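(* Let $G$ be a finite group and let $\mathfrak{o}$ be a complete discrete valuation ring with field of fractions $F$, such that $|G|$ is invertible in $F$. Let $\Lambda := \mathfrak{o}[G]$ and let $\Gamma\subset F[G]$ be a nice Fitting order over $\mathfrak{o}$ containing $\Lambda$, with decomposition $\Gamma = \bigoplus_{i=1}^k\Gamma_i$ and associated integers $n_i, s_i$ and inverse differents $\mathfrak{D}_i^{-1}$ as defined in the context. Then $$(\Gamma:\Lambda)_l = (\Gamma:\Lambda)_r = \bigoplus_{i=1}^k\frac{|G|}{n_is_i}\mathfrak{D}_i^{-1}.$$
   Context: $\zeta(\cdot)$ denotes the centre of a ring. A nice Fitting order over $\mathfrak{o}$ in $F[G]$ is an $\mathfrak{o}$-order in $F[G]$ that is a finite direct sum of rings each of which is either a maximal $\mathfrak{o}$-order or a matrix ring over a commutative ring. Write $\Gamma = \bigoplus_{i=1}^k\Gamma_i$, where each $\Gamma_i$ is isomorphic either to a matrix ring $M_{n_i\times n_i}(\mathfrak{o}_i)$ over a commutative ring $\mathfrak{o}_i$ (not necessarily integrally closed), in which case put $s_i=1$, or to a matrix ring $M_{n_i\times n_i}(\mathfrak{o}_{D_i})$ over the valuation ring $\mathfrak{o}_{D_i}$ of a skewfield $D_i$, in which case put $\mathfrak{o}_i := \zeta(\Gamma_i) = \zeta(\mathfrak{o}_{D_i})$ and let $s_i$ be the Schur index of $D_i$ (so $D_i$ has dimension $s_i^2$ over its centre). In both cases $\mathfrak{o}_i$ is a commutative noetherian complete local ring, assumed indecomposable. Put $A_i := F\otimes_{\mathfrak{o}}\Gamma_i$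 and $F_i := F\otimes_{\mathfrak{o}}\mathfrak{o}_i$ (not necessarily a field), so that $A:=F[G]=\bigoplus_i A_i$ and $\zeta(A)=\bigoplus_i F_i$. Let $\mathrm{tr}_i := \mathrm{Tr}_{F_i/F}\circ\mathrm{tr}_{A_i/F_i}$ be the reduced trace from $A_i$ to $F$, where $\mathrm{Tr}_{F_i/F}$ is the ordinary trace and $\mathrm{tr}_{A_i/F_i}$ the reduced trace. Define $\mathfrak{D}_i^{-1} := \{x\in A_i\mid\mathrm{tr}_i(x\Gamma_i)\subset\mathfrak{o}\}$ (not invertible in general). Conductors: $(\Gamma:\Lambda)_l := \{x\in\Gamma\mid x\Gamma\subset\Lambda\}$ and $(\Gamma:\Lambda)_r := \{x\in\Gamma\mid\Gamma x\subset\Lambda\}$. *)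

(* Defs.v *)
From HB Require Import structures.
From mathcomp Require Import all_boot all_order all_algebra all_fingroup all_field.
From mathcomp Require Import boolp classical_sets functions.

Set Implicit Arguments.
Unset Strict Implicit.
Unset Printing Implicit Defensive.

Import Order.TTheory GRing.Theory Num.Theory.
Local Open Scope classical_set_scope.
Local Open Scope ring_scope.

(* An alias of {ffun G -> F}, because the canonical ring structure of the
   latter is the pointwise one; here multiplication is convolution. *)
Definition group_algebra (F : fieldType) (G : finGroupType) : Type :=
  {ffun G -> F}.

Section GroupAlgebra.
Variables (F : fieldType) (G : finGroupType).
Local Notation FG := (group_algebra F G).

HB.instance Definition _ := Vector.copy FG {ffun G -> F^o}.

Definition ga_coef (x : FG) (g : G) : F := (x : {ffun G -> F}) g.
Definition ga_one : FG := [ffun g : G => (g == 1%g)%:R].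
Definition ga_mul (x y : FG) : FG :=
  [ffun g : G => \sum_(h : G) ga_coef x h * ga_coef y (h^-1 * g)%g].

Fact ga_mulE x y g :
  ga_coef (ga_mul x y) g = \sum_(h : G) ga_coef x h * ga_coef y (h^-1 * g)%g.
Proof. by rewrite /ga_coef ffunE. Qed.

Fact ga_addE (x y : FG) g : ga_coef (x + y) g = ga_coef x g + ga_coef y g.
Proof. by rewrite /ga_coef ffunE. Qed.

Fact ga_scaleE (c : F) (x : FG) g : ga_coef (c *: x) g = c * ga_coef x g.
Proof. by rewrite /ga_coef ffunE. Qed.

Fact ga_oneE g : ga_coef ga_one g = (g == 1%g)%:R.
Proof. by rewrite /ga_coef ffunE. Qed.

Fact ga_eqP (x y : FG) : (forall g, ga_coef x g = ga_coef y g) -> x = y.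
Proof. by move=> xy; apply/ffunP. Qed.

Fact ga_mulA : associative ga_mul.
Proof.
move=> x y z; apply: ga_eqP => g; rewrite !ga_mulE.
under eq_bigr => h _ do rewrite ga_mulE mulr_sumr.
under [RHS]eq_bigr => h _ do rewrite ga_mulE mulr_suml.
rewrite [RHS]exchange_big /=; apply: eq_bigr => h _.
rewrite [RHS](reindex_inj (mulgI h)) /=; apply: eq_bigr => j _.
by rewrite mulrA mulKg invMg mulgA.
Qed.

Fact ga_mul1 : left_id ga_one ga_mul.
Proof.
move=> x; apply: ga_eqP => g; rewrite ga_mulE (bigD1 1%g) //= ga_oneE eqxx.
rewrite mul1r invg1 mul1g big1 ?addr0 // => h hN1.
by rewrite ga_oneE (negPf hN1) mul0r.
Qed.

Fact ga_mulr1 : right_id ga_one ga_mul.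
Proof.
move=> x; apply: ga_eqP => g; rewrite ga_mulE (bigD1 g) //= ga_oneE mulVg eqxx.
rewrite mulr1 big1 ?addr0 // => h hNg.
by rewrite ga_oneE -eq_mulVg1 (negPf hNg) mulr0.
Qed.

Fact ga_mulDl : left_distributive ga_mul +%R.
Proof.
move=> x y z; apply: ga_eqP => g; rewrite ga_addE !ga_mulE -big_split /=.
by apply: eq_bigr => h _; rewrite ga_addE mulrDl.
Qed.

Fact ga_mulDr : right_distributive ga_mul +%R.
Proof.
move=> x y z; apply: ga_eqP => g; rewrite ga_addE !ga_mulE -big_split /=.
by apply: eq_bigr => h _; rewrite ga_addE mulrDr.
Qed.

Fact ga_one_neq0 : ga_one != 0 :> FG.
Proof.
apply/eqP => /(congr1 (fun x => ga_coef x 1%g)) /eqP.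
by rewrite ga_oneE eqxx /ga_coef ffunE oner_eq0.
Qed.

HB.instance Definition _ := GRing.Zmodule_isNzRing.Build FG
  ga_mulA ga_mul1 ga_mulr1 ga_mulDl ga_mulDr ga_one_neq0.

Fact ga_scaleAl (c : F) (x y : FG) : c *: (x * y) = (c *: x) * y.
Proof.
apply: ga_eqP => g; rewrite ga_scaleE !ga_mulE mulr_sumr.
by apply: eq_bigr => h _; rewrite ga_scaleE mulrA.
Qed.

HB.instance Definition _ :=
  GRing.Lmodule_isLalgebra.Build F FG ga_scaleAl.

Fact ga_scaleAr (c : F) (x y : FG) : c *: (x * y) = x * (c *: y).
Proof.
apply: ga_eqP => g; rewrite ga_scaleE !ga_mulE mulr_sumr.
by apply: eq_bigr => h _; rewrite ga_scaleE mulrCA.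
Qed.

HB.instance Definition _ :=
  GRing.Lalgebra_isAlgebra.Build F FG ga_scaleAr.

HB.instance Definition _ := Algebra_isFalgebra.Build F FG.

End GroupAlgebra.

(* A normalised discrete valuation on a (skew)field K; the value v 0 is
   irrelevant. *)
Definition discrete_valuation (K : nzRingType) (v : K -> int) : Prop :=
  [/\ forall x y, x != 0 -> y != 0 -> v (x * y) = v x + v y,
      forall x y, x != 0 -> y != 0 -> x + y != 0 ->
        Num.min (v x) (v y) <= v (x + y) &
      forall d : int, exists2 x, x != 0 & v x = d].

Definition valuation_ring (K : nzRingType) (v : K -> int) : set K :=
  [set x | x = 0 \/ 0 <= v x].

Definition val_close (K : nzRingType) (v : K -> int) (d : int) (x y : K) :=
  x - y = 0 \/ d <= v (x - y).

Definition val_complete (K : nzRingType) (v : K -> int) : Prop :=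
  forall u : nat -> K,
    (forall d : int, exists N : nat, forall p q : nat,
       (N <= p)%N -> (N <= q)%N -> val_close v d (u p) (u q)) ->
    exists l : K, forall d : int, exists N : nat, forall p : nat,
       (N <= p)%N -> val_close v d (u p) l.

Definition integers (o : idomainType) : set {fraction o} :=
  range (fun a : o => tofrac a).
Arguments integers o : clear implicits.

(* Completeness of the field for the valuation is the same as completeness of
   the valuation ring, which is open and closed in it. *)
Definition complete_dvr (o : idomainType) : Prop :=
  exists v : {fraction o} -> int,
    [/\ discrete_valuation v, integers o = valuation_ring v & val_complete v].

Definition is_identity (A : pzRingType) (S : set A) (e : A) : Prop :=
  S e /\ forall x, S x -> e * x = x /\ x * e = x.

Definition mul_closed (A : pzRingType) (S : set A) : Prop :=
  forall x y, S x -> S y -> S (x * y).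

Definition sub_closed (A : zmodType) (S : set A) : Prop :=
  S 0 /\ forall x y, S x -> S y -> S (x - y).

Definition is_ring (A : pzRingType) (S : set A) : Prop :=
  [/\ sub_closed S, mul_closed S & exists e, is_identity S e].

Definition centre (A : pzRingType) (S : set A) : set A :=
  [set z | S z /\ forall x, S x -> z * x = x * z].

(* S is nonzero, and is not a product of two nonzero rings (S commutative). *)
Definition indecomposable (A : pzRingType) (S : set A) : Prop :=
  (exists2 x, S x & x <> 0) /\
  forall z, S z -> z * z = z -> z = 0 \/ is_identity S z.

Definition ring_morph_on (A B : pzRingType) (S : set A) (f : A -> B) : Prop :=
  forall x y, S x -> S y -> f (x + y) = f x + f y /\ f (x * y) = f x * f y.

Definition is_direct_sum (A : zmodType) (k : nat) (S : set A)
    (T : 'I_k -> set A) : Prop :=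
  S = [set x | exists2 y : 'I_k -> A, forall i, T i (y i) & x = \sum_i y i] /\
  (forall y : 'I_k -> A, (forall i, T i (y i)) -> \sum_i y i = 0 ->
     forall i, y i = 0).

Definition ring_direct_sum (A : pzRingType) (k : nat) (S : set A)
    (T : 'I_k -> set A) : Prop :=
  [/\ is_direct_sum S T, forall i, is_ring (T i) &
      forall i j x y, i != j -> T i x -> T j y -> x * y = 0].

Section Span.
Variables (F : fieldType) (V : vectType F).

Definition is_Fspan (S : set V) (U : {vspace V}) : Prop :=
  (forall x, S x -> x \in U) /\
  forall W : {vspace V}, (forall x, S x -> x \in W) -> (U <= W)%VS.

(* When S is an o-submodule of V and F is the field of fractions of o, this is
   (the image in V of) the scalar extension of S from o to F: the natural map
   from the tensor product to V is injective, S being torsion-free. *)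
Definition Fspan (S : set V) : {vspace V} := xget 0%VS (is_Fspan S).

Lemma FspanP (S : set V) : is_Fspan S (Fspan S).
Proof.
have [U US] : exists U, is_Fspan S U;
  last exact: (@xgetPex _ 0%VS (is_Fspan S) (ex_intro _ U US)).
pose P d := `[< exists X : seq V,
  (forall x, x \in X -> S x) /\ \dim <<X>>%VS = d >].
have exP : exists d, P d.
  by exists 0%N; apply/asboolP; exists [::]; rewrite span_nil dimv0.
have ubP d : P d -> (d <= \dim {:V})%N.
  by move=> /asboolP[X [_ <-]]; apply: dimvS; apply: subvf.
case: (ex_maxnP exP ubP) => d /asboolP[X [XS dX]] maxd.
exists <<X>>%VS; split=> [x Sx|W SW]; last first.
  by apply/span_subvP => x /XS /SW.
have leXx : (<<X>> <= <<x :: X>>)%VS.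
  by apply: sub_span => y; rewrite inE orbC => ->.
have : (\dim <<x :: X>> <= d)%N.
  apply: maxd; apply/asboolP; exists (x :: X); split=> // y.
  by rewrite inE => /orP[/eqP-> //|/XS].
rewrite -dX => le; suff -> : <<X>>%VS = <<x :: X>>%VS.
  by apply: memv_span; rewrite inE eqxx.
by apply/eqP; rewrite eqEdim leXx.
Qed.

End Span.

(* Trace of x |-> z * x on the subspace U, for z * U contained in U. *)
Definition ordinary_trace (F : fieldType) (A : falgType F) (U : {vspace A})
    (z : A) : F :=
  \sum_(j < \dim U) coord (vbasis U) j (z * (vbasis U)`_j).

(* B is a subalgebra of A with commutative central subalgebra Z, and
   t : B -> Z is the reduced trace: there are a commutative ring E containing Z
   (through iota) and a Z-algebra map phi : B -> 'M_m(E) inducing an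
   isomorphism from the scalar extension of B from Z to E onto 'M_m(E), such
   that t is the usual matrix trace composed with phi.  The isomorphism
   condition says that phi maps a Z-basis of B to an E-basis of 'M_m(E).
   E may be a splitting field when Z is a field, and E = Z when B is a matrix
   ring over Z, Z being then possibly a product of several fields.  As
   m * iota (t x) is the image of the trace of y |-> x * y over Z, and m is
   invertible when B is a component of F[G], t does not depend on E or phi. *)
Definition is_reduced_trace (F : fieldType) (A : falgType F)
    (B Z : {vspace A}) (t : A -> A) : Prop :=
  exists (m : nat) (E : comNzRingType) (iota : A -> E) (phi : A -> 'M[E]_m)
         (b : 'I_(m ^ 2) -> A),
    [/\ [/\ ring_morph_on [set` Z] iota,
            {in Z &, injective iota},
            ring_morph_on [set` B] phi &
            {in Z, forall z, phi z = (iota z)%:M}],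
        [/\ forall j, b j \in B,
            {in B, forall x, exists! c : {ffun 'I_(m ^ 2) -> A},
               (forall j, c j \in Z) /\ x = \sum_j c j * b j} &
            forall M : 'M[E]_m, exists! c : {ffun 'I_(m ^ 2) -> E},
               M = \sum_j c j *: phi (b j)] &
        {in B, forall x, t x \in Z /\ iota (t x) = \tr (phi x)}].

Section Orders.
Variables (o : idomainType) (A : falgType {fraction o}).
Implicit Types (S T : set A).

Definition fin_gen S : Prop :=
  exists (r : nat) (X : 'I_r -> A),
    S = [set x | exists c : 'I_r -> o, x = \sum_j tofrac (c j) *: X j].

(* S is an o-order in the algebra U, whose identity may differ from 1. *)
Definition is_order (U : {vspace A}) S : Prop :=
  [/\ fin_gen S, mul_closed S, exists2 e, S e & is_identity [set` U] e &
      Fspan S = U].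

Definition maximal_order (U : {vspace A}) S : Prop :=
  is_order U S /\ forall T, is_order U T -> S `<=` T -> T = S.

Definition matrix_ring_over_comm S (n : nat) : Prop :=
  (0 < n)%N /\
  exists (R : comNzRingType) (f : 'M[R]_n -> A),
    ring_morph_on setT f /\ set_bij setT S f.

Definition nice_fitting_order S : Prop :=
  is_order fullv S /\
  exists (k : nat) (T : 'I_k -> set A),
    ring_direct_sum S T /\
    forall i, maximal_order (Fspan (T i)) (T i) \/
              exists n, matrix_ring_over_comm (T i) n.

(* oD is the valuation ring of the skewfield D, for the valuation of D that
   extends (up to normalisation) the one of the field of fractions of o. *)
Definition skewfield_valuation_ring (D : falgType {fraction o}) (oD : set D) :=
  [/\ forall x : D, x != 0 -> x \is a GRing.unit,
      exists2 w : D -> int, discrete_valuation w & oD = valuation_ring w &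
      forall c : {fraction o}, oD c%:A <-> integers o c].

(* The isomorphism is one of o-algebras. *)
Definition matrix_ring_over_valuation_ring S (n s : nat) : Prop :=
  (0 < n)%N /\
  exists (D : falgType {fraction o}) (oD : set D) (f : 'M[D]_n -> A),
    let MoD := [set M : 'M[D]_n | forall i j, oD (M i j)] in
    [/\ skewfield_valuation_ring oD,
        \dim {:D} = (s ^ 2 * \dim 'Z({:D}))%N,
        ring_morph_on MoD f,
        forall (c : o) M, MoD M ->
          f (map_mx ( *:%R (tofrac c)) M) = (tofrac c) *: f M &
        set_bij MoD S f].

Definition nice_component S (n s : nat) : Prop :=
  (matrix_ring_over_comm S n /\ s = 1%N) \/
  matrix_ring_over_valuation_ring S n s.

Definition inverse_different S (trd : A -> A) : set A :=
  [set x | x \in Fspan S /\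
     forall y, S y ->
       integers o (ordinary_trace (Fspan (centre S)) (trd (x * y)))].

Definition conductor_l S T : set A :=
  [set x | S x /\ forall y, S y -> T (x * y)].

Definition conductor_r S T : set A :=
  [set x | S x /\ forall y, S y -> T (y * x)].

End Orders.

Definition integral_group_ring (o : idomainType) (G : finGroupType) :
    set (group_algebra {fraction o} G) :=
  [set x | forall g, integers o (ga_coef x g)].
Arguments integral_group_ring o G : clear implicits.

(* Main.v *)
(* Let K be the fraction field of o and kappa : K[G] -> K the coefficient of 1.
   The form kappa (x * y) is symmetric and Lambda is its own dual, so, as Lambda
   is contained in Gamma, both conductors equal
   { x | kappa (x * y) \in o for all y in Gamma }, and this dual decomposes
   along the central idempotents of Gamma.  Now |G| * kappa (x) is the trace of
   left multiplication by x on K[G]; for x in A_i this is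
   m * Tr_{F_i/K} (trd x), where m ^ 2 is the rank of A_i over F_i.  Comparing
   the dimensions of A_i and F_i gives m = n_i * s_i. *)
Require Import Defs.
From HB Require Import structures.
From mathcomp Require Import all_boot all_order all_algebra all_fingroup all_field.
From mathcomp Require Import boolp classical_sets functions.

Set Implicit Arguments.
Unset Strict Implicit.
Unset Printing Implicit Defensive.

Import Order.TTheory GRing.Theory Num.Theory.
Local Open Scope classical_set_scope.
Local Open Scope ring_scope.

(** * Traces from spanning systems, and traces of left multiplications on matrices *)

(** Both sums are the trace of [f]: expand [f (a i)] along [b], exchange the sums and reassemble
    [b j] along [a]. The second system has to resolve only the image of [f], so the trace can be
    computed on an ideal containing that image. *)
Lemma trace_resolution (F : fieldType) (V : vectType F) (I J : finType)
    (a : I -> V) (alpha : I -> 'Hom(V, F^o)) (b : J -> V)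
    (beta : J -> 'Hom(V, F^o)) (f : 'End(V)) :
  (forall v, v = \sum_i alpha i v *: a i) ->
  (forall v, f v = \sum_j beta j (f v) *: b j) ->
  \sum_i alpha i (f (a i)) = \sum_j beta j (f (b j)).
Proof.
move=> aE bE; transitivity (\sum_i \sum_j beta j (f (a i)) * alpha i (b j)).
  apply: eq_bigr => i _; rewrite {1}bE linear_sum.
  by apply: eq_bigr => j _; rewrite linearZ.
rewrite exchange_big; apply: eq_bigr => j _.
rewrite [in RHS](aE (b j)) !linear_sum.
by apply: eq_bigr => i _; rewrite !linearZ /= mulrC.
Qed.

(** Left multiplication by [X] acts on each of the [m] columns separately; its diagonal entry at
    [(i, j)] is [X i i]. *)
Lemma mxtrace_lin_mulmx (E : comNzRingType) m (X : 'M[E]_m) :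
  \tr (lin_mx (mulmx X : 'M_m -> 'M_m)) = \tr X *+ m.
Proof.
rewrite /mxtrace (reindex _ (curry_mxvec_bij _ _)) /=.
rewrite (eq_bigr (fun p : 'I_m * 'I_m => X p.1 p.1)) => [|[i j] _] /=.
  rewrite -(pair_bigA _ (fun i _ => X i i)) /= -sumrMnl.
  by apply: eq_bigr => i _; rewrite sumr_const card_ord.
rewrite -[LHS](mxE matrix_key (fun (_ : 'I_1) l =>
  lin_mx (mulmx X) (mxvec_index i j) l) 0).
rewrite -/(row _ _) rowE -mxvec_delta mul_vec_lin mxvecE mxE (bigD1 i) //=.
by rewrite !mxE !eqxx mulr1 big1 ?addr0 // => l /negPf li; rewrite !mxE li mulr0.
Qed.

(** Over a commutative ring a one-sided inverse of a square matrix is two-sided, so a spanning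
    family of [m ^ 2] matrices is a basis. Hence [C] is conjugate to the matrix of left
    multiplication by [X]. *)
Lemma mxtrace_coords (E : comNzRingType) m (B : 'I_(m ^ 2) -> 'M[E]_m)
    (X : 'M[E]_m) (C : 'M[E]_(m ^ 2)) :
  (forall M : 'M[E]_m, exists c : 'I_(m ^ 2) -> E, M = \sum_j c j *: B j) ->
  (forall j, X *m B j = \sum_l C j l *: B l) ->
  \tr C = \tr X *+ m.
Proof.
move=> spanB XB.
(* The indices in [m ^ 2] and in [m * m] are identified by conversion. *)
pose P : 'M[E]_(m * m) := \matrix_j mxvec (B j).
have [q qE] := choice spanB.
pose Q : 'M[E]_(m * m) := \matrix_(p, j) q (vec_mx (delta_mx 0 p)) j.
have QP : Q *m P = 1%:M.
  apply/row_matrixP => p; rewrite row_mul row1.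
  rewrite -[RHS]vec_mxK (qE (vec_mx _)) linear_sum mulmx_sum_row.
  by apply: eq_bigr => j _; rewrite rowK !mxE linearZ.
have CP : (C : 'M_(m * m)) *m P = P *m lin_mx (mulmx X).
  apply/row_matrixP => j; rewrite !row_mul !rowK mul_vec_lin /= XB linear_sum.
  rewrite mulmx_sum_row; apply: eq_bigr => l _.
  by rewrite rowK !mxE linearZ.
rewrite -mxtrace_lin_mulmx -[lin_mx _]mul1mx -QP -mulmxA -CP.
by rewrite mxtrace_mulC -mulmxA (mulmx1C QP) mulmx1.
Qed.

(** * Bases of a subspace with coefficients in another subspace *)

Section RelativeBasis.
Variables (F : fieldType) (A : falgType F) (Z B : {vspace A}).
Variables (I : finType) (b : I -> A).

(** Coefficients live in [subvs_of Z], which makes [comb] an [F]-linear map of vector spaces; for a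
    relative basis it is a bijection onto [B], which yields both the dimension and the
    coordinates. *)
Definition comb (c : {ffun I -> subvs_of Z}) : A := \sum_i vsval (c i) * b i.

Fact comb_is_linear : linear comb.
Proof.
move=> k c d; rewrite /comb scaler_sumr -big_split; apply: eq_bigr => i _.
by rewrite !ffunE linearP mulrDl scalerAl.
Qed.
HB.instance Definition _ := GRing.isLinear.Build F _ A _ comb comb_is_linear.

Definition rel_basis : Prop :=
  [/\ forall c : I -> A, (forall i, c i \in Z) -> \sum_i c i * b i \in B,
      forall x, x \in B ->
        exists2 c : I -> A, (forall i, c i \in Z) & x = \sum_i c i * b i &
      forall c : I -> A, (forall i, c i \in Z) -> \sum_i c i * b i = 0 ->
        forall i, c i = 0].

Hypothesis bP : rel_basis.

Lemma lker0_comb : lker (linfun comb) == 0%VS.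
Proof.
case: bP => _ _ b0; apply/eqP/vspaceP => c; rewrite memv_ker memv0 lfunE.
apply/eqP/eqP => [/b0 c0|->]; last exact: linear0.
apply/ffunP => i; rewrite ffunE; apply: subvs_inj.
by rewrite c0 ?linear0 // => j; apply: subvsP.
Qed.

Lemma limg_comb : limg (linfun comb) = B.
Proof.
case: bP => bB Bb _; apply/vspaceP => x; apply/memv_imgP/idP => [[c _ ->]|/Bb].
  by rewrite lfunE; apply: bB => i; apply: subvsP.
case=> c cZ ->; exists [ffun i => vsproj Z (c i)]; first exact: memvf.
by rewrite lfunE; apply: eq_bigr => i _; rewrite ffunE vsprojK.
Qed.

Lemma dim_rel_basis : \dim B = (#|I| * \dim Z)%N.
Proof.
rewrite -limg_comb limg_dim_eq; first by rewrite dimvf.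
by rewrite (eqP lker0_comb) capv0.
Qed.

(** Meaningful only on [B], the image of [comb]. *)
Definition rel_coord : 'Hom(A, {ffun I -> subvs_of Z}) := (linfun comb)^-1%VF.

Lemma rel_coordE x : x \in B -> x = \sum_i vsval (rel_coord x i) * b i.
Proof.
rewrite -limg_comb => /memv_imgP[c _ ->].
by rewrite /rel_coord lker0_lfunK ?lker0_comb // lfunE.
Qed.

Lemma rel_coord_sum (c : I -> A) i : (forall i, c i \in Z) ->
  vsval (rel_coord (\sum_i c i * b i) i) = c i.
Proof.
move=> cZ; have -> : \sum_i c i * b i = linfun comb [ffun i => vsproj Z (c i)].
  by rewrite lfunE; apply: eq_bigr => j _; rewrite ffunE vsprojK.
by rewrite /rel_coord lker0_lfunK ?lker0_comb // ffunE vsprojK.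
Qed.

End RelativeBasis.

(** * Ordinary and reduced traces *)

Lemma ring_morph_on_sum (R1 R2 : pzRingType) (S : set R1) (f : R1 -> R2)
    (I : finType) (c : I -> R1) :
  S 0 -> (forall x y, S x -> S y -> S (x + y)) -> ring_morph_on S f ->
  (forall i, S (c i)) -> f (\sum_i c i) = \sum_i f (c i).
Proof.
move=> S0 SD fM Sc; have f0 : f 0 = 0.
  by apply: (addrI (f 0)); rewrite -(fM 0 0 S0 S0).1 !addr0.
suff [] : S (\sum_i c i) /\ f (\sum_i c i) = \sum_i f (c i) by [].
elim/big_rec2: _ => // i y x _ [Sx fx]; split; first exact: SD.
by rewrite (fM _ _ (Sc i) Sx).1 fx.
Qed.

Section OrdinaryTrace.
Variables (F : fieldType) (A : falgType F) (U : {vspace A}).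

Fact ordinary_trace_is_linear :
  linear_for *%R (ordinary_trace U : A -> F).
Proof.
move=> k x y; rewrite /ordinary_trace mulr_sumr -big_split.
by apply: eq_bigr => j _; rewrite mulrDl -scalerAl linearP.
Qed.
HB.instance Definition _ :=
  GRing.isLinear.Build F A F *%R (ordinary_trace U) ordinary_trace_is_linear.

End OrdinaryTrace.

Section ReducedTrace.
Variables (F : fieldType) (A : falgType F) (B Z : {vspace A}) (t : A -> A).
Hypothesis ZB : (Z <= B)%VS.
Hypothesis ZZ : forall z w, z \in Z -> w \in Z -> z * w \in Z.
Hypothesis BA : forall x v, x \in B -> x * v \in B.
Hypothesis ZC : forall z x, z \in Z -> x \in B -> z * x = x * z.

(* The trace of left multiplication by x on the ideal B, computed in the basis
   obtained from a K-basis of Z and a Z-basis of B, is Tr_{Z/K} of the trace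
   over Z; after extending scalars to E the latter is m times the matrix
   trace of phi x. *)
Lemma trace_mul_reduced_trace : is_reduced_trace B Z t ->
  exists m : nat, \dim B = (m ^ 2 * \dim Z)%N /\
  forall (I : finType) (a : I -> A) (alpha : I -> 'Hom(A, F^o)),
    (forall v, v = \sum_i alpha i v *: a i) ->
    forall x, x \in B ->
      \sum_i alpha i (x * a i) = m%:R * ordinary_trace Z (t x).
Proof.
case=> m [E [iota [phi [b [[iotaM iota_inj phiM phiZ] [bB bU EU] tP]]]]].
have BZ z : z \in Z -> z \in B by move/(subvP ZB).
have bP : rel_basis Z B b.
  split=> [c cZ|x xB|c cZ c0 i].
  - by apply: memv_suml => i _; rewrite BA ?BZ.
  - by have [c [[cZ ->] _]] := bU _ xB; exists c.
  (* Independence is the uniqueness of the coordinates of 0: both [c] and the zero family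
     qualify. *)
  have [d [_ dU]] := bU _ (mem0v B).
  have e0 : d = [ffun=> 0].
    apply: dU; split=> [j|]; first by rewrite ffunE mem0v.
    by rewrite big1 // => j _; rewrite ffunE mul0r.
  have /ffunP/(_ i) : d = [ffun j => c j].
    apply: dU; split=> [j|]; first by rewrite ffunE.
    by rewrite -{1}c0; apply: eq_bigr => j _; rewrite ffunE.
  by rewrite e0 !ffunE.
exists m; split=> [|I a alpha aE x xB]; first by rewrite (dim_rel_basis bP) card_ord.
pose C j l := vsval (rel_coord Z b (x * b j) l).
have CZ j l : C j l \in Z by apply: subvsP.
have xb j : x * b j = \sum_l C j l * b l.
  by apply: (rel_coordE bP); apply: BA.
(* A basis of [B] over [F]: the products of a basis of [Z] with the [b j]. The form [beta0 (j, q)]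
   reads coordinate [q] in [Z] of coordinate [j] over [Z]. *)
pose J := ('I_(m ^ 2) * 'I_(\dim Z))%type.
pose beta0 (p : J) (y : A) : F^o :=
  coord (vbasis Z) p.2 (vsval (rel_coord Z b y p.1)).
have beta_lin p : linear (beta0 p).
  by move=> k y z; rewrite /beta0 linearP !ffunE !linearP.
pose betaL p := GRing.isLinear.Build F A F^o _ (beta0 p) (beta_lin p).
pose beta p : 'Hom(A, F^o) := linfun (HB.pack (beta0 p) (betaL p) : {linear A -> F^o}).
have betaE p y : beta p y = beta0 p y by rewrite lfunE.
pose bJ (p : J) := (vbasis Z)`_p.2 * b p.1.
have zZ (q : 'I_(\dim Z)) : (vbasis Z)`_q \in Z.
  by apply: vbasis_mem; rewrite mem_nth ?size_tuple.
(* Since [B] is an ideal containing [x], the system [bJ] resolves the image of left multiplication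
   by [x]. *)
transitivity (\sum_p beta p (amull x (bJ p))).
  rewrite -(trace_resolution (f := amull x) aE).
    by apply: eq_bigr => i _; rewrite lfunE.
  move=> v; rewrite lfunE /= {1}(rel_coordE bP (BA v xB)).
  rewrite -(pair_bigA _ (fun j q => beta (j, q) (x * v) *: bJ (j, q))) /=.
  apply: eq_bigr => j _; rewrite {1}(coord_vbasis (subvsP _)) mulr_suml.
  by apply: eq_bigr => q _; rewrite betaE scalerAl.
(* By injectivity of [iota] on [Z] this can be checked in [E], where the image of [C] is the matrix
   of left multiplication by [phi x] in the spanning family [phi (b j)]. *)
have Ct : \sum_j C j j = t x *+ m.
  have [tZ it] := tP _ xB.
  have Z0 : [set` Z] 0 by exact: mem0v.
  have ZD u v : [set` Z] u -> [set` Z] v -> [set` Z] (u + v).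
    by move=> uZ vZ; apply: memvD.
  have B0 : [set` B] 0 by exact: mem0v.
  have BD u v : [set` B] u -> [set` B] v -> [set` B] (u + v).
    by move=> uZ vZ; apply: memvD.
  apply: iota_inj; [by apply: memv_suml | by rewrite rpredMn |].
  rewrite (ring_morph_on_sum Z0 ZD iotaM (fun j => CZ j j)).
  rewrite -[m in RHS]card_ord -sumr_const.
  rewrite (ring_morph_on_sum Z0 ZD iotaM (fun _ => tZ)) sumr_const card_ord it.
  rewrite -(@mxtrace_coords _ _ (fun j => phi (b j)) (phi x)
    (\matrix_(j, l) iota (C j l))).
  - by apply: eq_bigr => j _; rewrite mxE.
  - by move=> M; have [c [-> _]] := EU M; exists c.
  move=> j; transitivity (phi (x * b j)); first exact/esym/(phiM _ _ xB (bB j)).2.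
  rewrite xb.
  rewrite (ring_morph_on_sum B0 BD phiM) => [|l]; last by apply: BA; apply: BZ.
  apply: eq_bigr => l _; rewrite (phiM _ _ (BZ _ (CZ j l)) (bB l)).2.
  by rewrite (phiZ _ (CZ j l)) mxE -mul_scalar_mx.
rewrite -(pair_bigA _ (fun j q => beta (j, q) (amull x (bJ (j, q))))) /=.
rewrite mulr_natl -raddfMn /= -Ct raddf_sum /=; apply: eq_bigr => j _.
apply: eq_bigr => q _; rewrite betaE lfunE /= /beta0 /bJ /=.
(* With [z] the basis vector of [Z] at [q], centrality gives
   [x * (z * b j) = \sum_l (z * C j l) * b l], whose coordinate at [j] is [z * C j j]. *)
rewrite mulrA -(ZC (zZ q) xB) -mulrA xb mulr_sumr.
under eq_bigr => l _ do rewrite mulrA.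
rewrite (rel_coord_sum bP) => [|l]; last exact: ZZ.
by rewrite (ZC (zZ q)) ?BZ.
Qed.

End ReducedTrace.

(** * Passing from a set to its linear span *)

Section FspanTheory.
Variable F : fieldType.

Lemma mem_Fspan (V : vectType F) (S : set V) x : S x -> x \in Fspan S.
Proof. exact: (FspanP S).1. Qed.

Lemma Fspan_sub (V : vectType F) (S : set V) (W : {vspace V}) :
  (forall x, S x -> x \in W) -> (Fspan S <= W)%VS.
Proof. exact: (FspanP S).2. Qed.

Lemma Fspan_eqfun (V W : vectType F) (S : set V) (f g : 'Hom(V, W)) :
  (forall x, S x -> f x = g x) -> {in Fspan S, f =1 g}.
Proof.
move=> fg x; have /subvP/[apply] : (Fspan S <= lker (f - g))%VS.
  by apply: Fspan_sub => y Sy; rewrite memv_ker !lfunE /= lfunE /= fg ?subrr.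
by rewrite memv_ker !lfunE /= lfunE /= subr_eq0 => /eqP.
Qed.

Lemma Fspan_mul (A : falgType F) (S T U : set A) :
  (forall x y, S x -> T y -> U (x * y)) ->
  forall x y, x \in Fspan S -> y \in Fspan T -> x * y \in Fspan U.
Proof.
move=> STU x y xS yT.
have xT z : T z -> x * z \in Fspan U.
  move=> Tz; have /subvP/(_ _ xS) : (Fspan S <= amulr z @^-1: Fspan U)%VS.
    by apply: Fspan_sub => w Sw; rewrite -memv_preim lfunE; apply/mem_Fspan/STU.
  by rewrite -memv_preim lfunE.
have /subvP/(_ _ yT) : (Fspan T <= amull x @^-1: Fspan U)%VS.
  by apply: Fspan_sub => w Tw; rewrite -memv_preim lfunE; apply: xT.
by rewrite -memv_preim lfunE.
Qed.

Lemma Fspan_comm (A : falgType F) (S T : set A) :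
  (forall x y, S x -> T y -> x * y = y * x) ->
  forall x y, x \in Fspan S -> y \in Fspan T -> x * y = y * x.
Proof.
move=> ST x y xS yT; have := @Fspan_eqfun _ _ T (amull x) (amulr x) _ y yT.
rewrite !lfunE; apply=> {yT}y Ty.
have := @Fspan_eqfun _ _ S (amulr y) (amull y) _ x xS.
by rewrite !lfunE; apply=> {xS}x Sx; rewrite !lfunE; apply: ST.
Qed.

(** As long as a free family taken from [S] is smaller than the dimension of the span, some element
    of [S] lies outside its span and can be added. *)
Lemma Fspan_basis (V : vectType F) (S : set V) :
  exists X : seq V, [/\ forall x, x \in X -> S x, free X & <<X>>%VS = Fspan S].
Proof.
have sub X : (forall x, x \in X -> S x) -> (<<X>> <= Fspan S)%VS.
  by move=> XS; apply/span_subvP => x /XS/mem_Fspan.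
suff [X [XS fX sX]] : exists X : seq V,
    [/\ forall x, x \in X -> S x, free X & size X = \dim (Fspan S)].
  exists X; split=> //; apply/eqP; rewrite eqEdim sub //= -sX.
  by rewrite (eqP fX).
have: (\dim (Fspan S) <= \dim (Fspan S))%N by [].
elim: {1 3}(\dim _) => [|d IHd] led; first by exists [::]; split; rewrite ?nil_free.
have [X [XS fX sX]] := IHd (ltnW led).
have [y Sy yX] : exists2 y, S y & y \notin <<X>>%VS.
  apply/not_exists2P => SX; move: led; rewrite -sX -(eqP fX) ltnNge => /negP; apply.
  by apply/dimvS/Fspan_sub => x Sx; case: (SX x) => // /negP/negPn.
exists (y :: X); split=> [x|| /=]; last by rewrite sX.
  by rewrite inE => /predU1P[->|/XS].
by rewrite free_cons yX.
Qed.

End FspanTheory.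

(** * Clearing denominators *)

Section FractionField.
Variable o : idomainType.
Local Notation K := {fraction o}.

Lemma fraction_denom (x : K) :
  exists2 d : o, d != 0 & exists c : o, tofrac d * x = tofrac c.
Proof.
elim/quotW: x => r; exists \d_r; first exact: denom_ratioP.
exists \n_r; rewrite !piE; apply/eqmodP.
rewrite /= equivfE !numden_Ratio ?mulf_neq0 ?denom_ratioP ?oner_neq0 //.
by rewrite mul1r mulr1 mulrC.
Qed.

Lemma common_denom (I : finType) (x : I -> K) :
  exists2 d : o, d != 0 & exists c : I -> o, forall i, tofrac d * x i = tofrac (c i).
Proof.
have /choice[dc dcP] i : exists dc : o * o,
    dc.1 != 0 /\ tofrac dc.1 * x i = tofrac dc.2.
  by have [d d0 [c dcx]] := fraction_denom (x i); exists (d, c).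
exists (\prod_i (dc i).1); first by apply/prodf_neq0 => i _; have [] := dcP i.
exists (fun i => (\prod_(j | j != i) (dc j).1) * (dc i).2) => i.
by rewrite (bigD1 i) //= !rmorphM /= -mulrA mulrCA (dcP i).2.
Qed.

(** [g] is only additive and [o]-homogeneous on [S], yet it carries a basis of the span taken from
    [S] to a basis of the span of the image: linear relations over the fraction field become
    relations over [o] after clearing denominators. *)
Lemma dim_Fspan_image (V W : vectType K) (S : set V) (g : V -> W) :
  S 0 -> (forall x y, S x -> S y -> S (x + y)) ->
  (forall (c : o) x, S x -> S (tofrac c *: x)) ->
  (forall x y, S x -> S y -> g (x + y) = g x + g y) ->
  (forall (c : o) x, S x -> g (tofrac c *: x) = tofrac c *: g x) ->
  set_inj S g ->
  \dim (Fspan (g @` S)) = \dim (Fspan S).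
Proof.
move=> S0 SD SZ gD gZ g_inj.
have g0 : g 0 = 0 by apply: (addrI (g 0)); rewrite -gD // !addr0.
have [X [XS fX spanX]] := Fspan_basis S; rewrite -spanX.
have XSi (i : 'I_(size X)) : S X`_i by apply/XS/mem_nth.
have gsum (c : 'I_(size X) -> o) : let y := \sum_i tofrac (c i) *: X`_i in
    S y /\ g y = \sum_i tofrac (c i) *: g X`_i.
  move=> /=; elim/big_rec2: _ => // i y x _ [Sx <-]; split.
    by apply: SD => //; apply: SZ.
  by rewrite gD ?gZ //; apply: SZ.
have gX (i : 'I_(size X)) : (map g X)`_i = g X`_i by rewrite (nth_map 0).
(* A relation among the images, multiplied by a common denominator, pulls back through the injective
   [g]. *)
have free_gX : free (map g X).
  rewrite -[map g X]/(val (map_tuple g (in_tuple X))); apply/freeP => k k0.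
  have [d d0 [c dk]] := common_denom k.
  have [Sy gy] := gsum c.
  have : \sum_i tofrac (c i) *: X`_i = 0.
    apply: g_inj; rewrite ?inE // gy g0; transitivity (tofrac d *: (0 : W)).
      by rewrite -[in RHS]k0 scaler_sumr; apply: eq_bigr => i _; rewrite scalerA dk /= gX.
    exact: scaler0.
  move/(elimT (freeP (X := in_tuple X)) fX) => c0 i.
  have /eqP := dk i; rewrite c0 mulf_eq0 tofrac_eq0 (negPf d0) /=.
  by move/eqP.
have -> : Fspan (g @` S) = <<map g X>>%VS; last first.
  by rewrite (eqP free_gX) (eqP fX) size_map.
apply/eqP; rewrite eqEsubv; apply/andP; split; last first.
  by apply/span_subvP => _ /mapP[x /XS Sx ->]; apply: mem_Fspan; exists x.
apply: Fspan_sub => _ [x Sx <-]; have := mem_Fspan Sx.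
rewrite -spanX -[X]/(val (in_tuple X)) => /coord_span xE.
have [d d0 [c dc]] := common_denom (fun i => coord (in_tuple X) i x).
have dx : tofrac d *: x = \sum_i tofrac (c i) *: X`_i.
  by rewrite xE scaler_sumr; apply: eq_bigr => i _; rewrite scalerA dc.
rewrite -[g x]scale1r -(mulVf (_ : tofrac d != 0)) ?tofrac_eq0 // -scalerA.
apply: memvZ; rewrite -gZ // dx (gsum c).2; apply: memv_suml => i _.
by apply/memvZ/memv_span/map_f/mem_nth.
Qed.
End FractionField.

(** * Dimension of a nice component over its centre *)

Section ComponentDimension.
Variables (o : idomainType) (A : falgType {fraction o}).
Local Notation K := {fraction o}.

(** The images of the matrix units form a basis of the span of [S] over the span of its centre;
    matrix entries [a] enter as the central elements [f a%:M]. *)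
Lemma dim_matrix_ring_over_comm (S : set A) (n : nat) :
  mul_closed S -> matrix_ring_over_comm S n ->
  \dim (Fspan S) = (n ^ 2 * \dim (Fspan (centre S)))%N.
Proof.
move=> SM [n0 [R [f [fM [f_S f_inj f_surj]]]]].
have fD M N : f (M + N) = f M + f N by have [] := fM M N.
have fmul M N : f (M *m N) = f M * f N by have [] := fM M N.
have fS M : S (f M) by apply: f_S.
have f0 : f 0 = 0 by apply: (addrI (f 0)); rewrite -fD !addr0.
have fsum (I : finType) (M : I -> 'M[R]_n) : f (\sum_i M i) = \sum_i f (M i).
  exact: (big_morph f fD f0).
have f1 x : x \in Fspan S -> x * f 1%:M = x.
  move=> xS; have := @Fspan_eqfun _ _ _ S (amulr (f 1%:M)) (amulr 1) _ x xS.
  rewrite !lfunE /= mulr1; apply=> _ /f_surj[M _ <-].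
  by rewrite !lfunE /= mulr1 -fmul mulmx1.
have ZC c x : c \in Fspan (centre S) -> x \in Fspan S -> c * x = x * c.
  by apply: Fspan_comm => u v [_ uC] /uC.
have ZS c x : c \in Fspan (centre S) -> x \in Fspan S -> c * x \in Fspan S.
  by apply: Fspan_mul => u v [Su _] /(SM _ _ Su).
have fF M : f M \in Fspan S by apply: mem_Fspan.
have fZ a : centre S (f a%:M).
  by split=> // _ /f_surj[M _ <-]; rewrite -!fmul scalar_mxC.
pose b (p : 'I_n * 'I_n) := f (delta_mx p.1 p.2).
rewrite (@dim_rel_basis _ _ (Fspan (centre S)) _ _ b); first by rewrite card_prod card_ord.
split=> [c cZ|x xS|c cZ c0 [i j]].
- by apply: memv_suml => p _; apply: ZS (fF _).
(* The combinations with central coefficients form a subspace, so it suffices to reach the elements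
   of [S] itself. *)
- have : x \in limg (linfun (@comb _ _ (Fspan (centre S)) _ b)).
    move: x xS; apply/subvP/Fspan_sub => _ /f_surj[M _ <-].
    apply/memv_imgP; exists [ffun p => vsproj _ (f (M p.1 p.2)%:M)].
      exact: memvf.
    rewrite lfunE {1}(matrix_sum_delta M) pair_bigA fsum; apply: eq_bigr => p _.
    by rewrite ffunE vsprojK -?fmul ?mul_scalar_mx //; apply/mem_Fspan/fZ.
  case/memv_imgP=> c _ ->; exists (fun p => vsval (c p)); first by move=> p; apply: subvsP.
  by rewrite lfunE.
(* Sandwiching between matrix units isolates [c (i, j)] at the diagonal position [k]; summing over
   [k] recovers [c (i, j)] times the identity. *)
have fE k : f (delta_mx k i) * (\sum_p c p * b p) * f (delta_mx j k) =
    c (i, j) * f (delta_mx k k).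
  rewrite mulr_sumr mulr_suml (bigD1 (i, j)) //= big1 ?addr0 => [|[p q] pq].
    by rewrite mulrA -(ZC _ _ (cZ _) (fF _)) -!mulrA -!fmul !mul_delta_mx.
  rewrite mulrA -(ZC _ _ (cZ _) (fF _)) -!mulrA -!fmul /=.
  suff -> : delta_mx k i *m (delta_mx p q *m delta_mx j k) = 0 :> 'M[R]_n.
    by rewrite f0 mulr0.
  rewrite mul_delta_mx_cond; case: (eqVneq q j) pq => [->|_ _]; last first.
    by rewrite mulr0n mulmx0.
  rewrite mulr1n mul_delta_mx_cond; case: (eqVneq i p) => [->|_ _]; last by rewrite mulr0n.
  by rewrite eqxx.
have cS : c (i, j) \in Fspan S.
  by apply: (subvP (Fspan_sub _)) (cZ _) => u [Su _]; apply: mem_Fspan.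
rewrite -(f1 _ cS) mx1_sum_delta fsum mulr_sumr big1 // => k _.
by rewrite -fE c0 mulr0 mul0r.
Qed.

Variable v : K -> int.
Hypotheses (vP : discrete_valuation v) (ov : integers o = valuation_ring v).

Section ValuationRing.
Variables (D : falgType K) (oD : set D).
Hypothesis oDP : skewfield_valuation_ring oD.

Let mulD_neq0 (x y : D) : x != 0 -> y != 0 -> x * y != 0.
Proof.
case: oDP => DU _ _ x0 y0; apply: contraNneq y0 => xy0.
by rewrite -(mulKr (DU _ x0) y) xy0 mulr0.
Qed.

Lemma valuation_ring_subring :
  [/\ oD 0, oD 1, forall x y, oD x -> oD y -> oD (x + y),
      forall x y, oD x -> oD y -> oD (x * y) &
      forall (c : o) x, oD x -> oD (tofrac c *: x)].
Proof.
case: oDP => _ [w [wM wD _] oDE] oDo.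
have oD0 : oD 0 by rewrite oDE; left.
have oDM x y : oD x -> oD y -> oD (x * y).
  rewrite oDE => -[->|wx]; first by rewrite mul0r; left.
  move=> [->|wy]; first by rewrite mulr0; left.
  have [->|x0] := eqVneq x 0; first by rewrite mul0r; left.
  have [->|y0] := eqVneq y 0; first by rewrite mulr0; left.
  by right; rewrite wM // addr_ge0.
have oDi (c : o) : oD (tofrac c)%:A by apply/oDo; exists c.
split=> // [|x y|c x oDx]; last by rewrite -mulr_algl; apply: oDM.
- by have := oDi 1; rewrite rmorph1 scale1r.
rewrite oDE => -[->|wx]; first by rewrite add0r.
move=> [->|wy]; first by rewrite addr0; right.
have [->|x0] := eqVneq x 0; first by rewrite add0r; right.
have [->|y0] := eqVneq y 0; first by rewrite addr0; right.
have [->|xy0] := eqVneq (x + y) 0; first by left.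
by right; apply: le_trans (wD _ _ x0 y0 xy0); rewrite le_min wx.
Qed.

(** The valuations [w] and [v] are linked only through [oD] meeting the base field in [o]. This
    suffices: if [v x = -1] then [x] is not in [o], so [w] is negative at [x] and at least 1 at its
    inverse, whose powers therefore have arbitrarily large valuation. *)
Lemma scale_into_valuation_ring (I : finType) (u : I -> D) :
  exists2 c : K, c != 0 & forall i, oD (c *: u i).
Proof.
case: oDP => _ [w [wM _ _] oDE] oDo; case: vP => _ _ /(_ (-1))[x x0 vx].
have A0 (c : K) : c != 0 -> c%:A != 0 :> D by rewrite scaler_eq0 oner_eq0 orbF.
have w1 : w 1 = 0.
  by apply: (addrI (w 1)); rewrite -wM ?oner_neq0 // mulr1 addr0.
have wx : w x%:A < 0.
  rewrite ltNge; apply/negP => wx; have /oDo : oD x%:A by rewrite oDE; right.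
  rewrite ov => -[/eqP|]; first by rewrite (negPf x0).
  by rewrite vx.
have wp : 1 <= w (x^-1)%:A.
  have : w x%:A + w (x^-1)%:A = 0.
    by rewrite -wM ?A0 ?invr_neq0 // mulr_algl scalerA divff // scale1r.
  by move/addr0_eq <-; rewrite -gtz0_ge1 oppr_gt0.
have wpX k : k%:Z <= w (x^-1 ^+ k)%:A.
  elim: k => [|k IHk]; first by rewrite expr0 scale1r w1.
  rewrite exprS -scalerA -mulr_algl wM ?A0 ?expf_neq0 ?invr_neq0 //.
  by rewrite intS lerD.
(* The exponent dominates every [|w (u i)|]; the arbitrary value of [w] at a zero entry can only
   enlarge it. *)
exists (x^-1 ^+ (\sum_i `|w (u i)|)); first by rewrite expf_neq0 ?invr_neq0.
move=> i; rewrite oDE; have [->|u0] := eqVneq (u i) 0; first by left; rewrite scaler0.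
right; rewrite -mulr_algl wM ?A0 ?expf_neq0 ?invr_neq0 //.
rewrite -lerBlDr sub0r; apply: le_trans (wpX _).
apply: le_trans (_ : (`|w (u i)|%N)%:Z <= _); first by rewrite abszE -normrN ler_norm.
by rewrite lez_nat (bigD1 i) //= leq_addr.
Qed.

Lemma Fspan_valuation_functions (I : finType) :
  Fspan [set u : {ffun I -> D} | forall i, oD (u i)] = fullv.
Proof.
apply/vspaceP => u; rewrite memvf.
have [c c0 cu] := scale_into_valuation_ring u.
rewrite -[u]scale1r -(mulVf c0) -scalerA memvZ // mem_Fspan // => i.
by rewrite ffunE.
Qed.

Lemma Fspan_valuation_centre :
  Fspan [set z | oD z /\ z \in 'Z({:D})%VS] = 'Z({:D})%VS.
Proof.
apply/eqP; rewrite eqEsubv Fspan_sub => [|z []//]; apply/subvP => z zZ.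
have [c c0 /(_ tt) cz] := scale_into_valuation_ring (fun _ : unit => z).
rewrite -[z]scale1r -(mulVf c0) -scalerA memvZ // mem_Fspan //.
by split=> //; apply: memvZ.
Qed.

Lemma valuation_ring_centre z :
  (forall y, oD y -> z * y = y * z) -> z \in 'Z({:D})%VS.
Proof.
move=> zC; rewrite memv_cap memvf; apply/centvP => y _.
have [c c0 /(_ tt) cy] := scale_into_valuation_ring (fun _ : unit => y).
by apply: (scalerI c0); rewrite scalerAr scalerAl zC.
Qed.

End ValuationRing.

(** [S] and its centre are injective [o]-linear images of the integral matrices over [D] and of the
    integral central elements of [D]. Their spans thus have dimensions [n ^ 2 * \dim {:D}] and that
    of the centre of [D]. *)
Lemma dim_matrix_ring_over_valuation_ring (S : set A) (n s : nat) :
  matrix_ring_over_valuation_ring S n s ->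
  \dim (Fspan S) = ((n * s) ^ 2 * \dim (Fspan (centre S)))%N.
Proof.
case=> n0 [D [oD [f [oDP dimD fM fZ [f_S f_inj f_surj]]]]].
set MoD : set _ := [set M | _] in fM fZ f_S f_inj f_surj.
have [oD0 oD1 oDD oDM oDZ] := valuation_ring_subring oDP.
have MoDD M N : MoD M -> MoD N -> MoD (M + N).
  by move=> MoDM MoDN i j; rewrite mxE; apply: oDD.
have MoDM M N : MoD M -> MoD N -> MoD (M *m N).
  move=> MoDM MoDN i j; rewrite mxE; elim/big_ind: _ => // k _.
  exact: oDM.
have MoDs z : oD z -> MoD z%:M.
  by move=> oDz i j; rewrite mxE; case: (i == j).
have MoDd i j : MoD (delta_mx i j).
  by move=> k l; rewrite mxE; case: (_ && _).
have fmul M N : MoD M -> MoD N -> f (M *m N) = f M * f N.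
  by move=> MoDM1 MoDN; have [] := fM M N MoDM1 MoDN.
have inj M N : MoD M -> MoD N -> f M = f N -> M = N.
  by move=> MoDM1 MoDN; apply: f_inj; rewrite inE.
have dimS : \dim (Fspan S) = (n ^ 2 * \dim {:D})%N.
  (* Matrices are replaced by functions on pairs of indices, which form a vector space over the
     fraction field. *)
  pose T := [set u : {ffun 'I_n * 'I_n -> D} | forall p, oD (u p)].
  pose mx (u : {ffun 'I_n * 'I_n -> D}) : 'M[D]_n := \matrix_(i, j) u (i, j).
  have MoDmx u : T u -> MoD (mx u) by move=> Tu i j; rewrite mxE.
  have -> : S = (f \o mx) @` T.
    apply/seteqP; split=> [_ /f_surj[M MoDM1 <-]|_ [u Tu <-]]; last exact/f_S/MoDmx.
    exists [ffun p => M p.1 p.2]; first by move=> p; rewrite ffunE; apply: MoDM1.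
    by congr f; apply/matrixP => i j; rewrite mxE ffunE.
  rewrite dim_Fspan_image.
  - by rewrite Fspan_valuation_functions // !dimvf /dim /= card_prod card_ord.
  - by move=> p; rewrite ffunE.
  - by move=> x y Tx Ty p; rewrite ffunE; exact: oDD (Tx p) (Ty p).
  - by move=> c x Tx p; rewrite ffunE; exact: oDZ (Tx p).
  - move=> x y Tx Ty /=; rewrite -(fM _ _ (MoDmx _ Tx) (MoDmx _ Ty)).1.
    by congr f; apply/matrixP => i j; rewrite !mxE ffunE.
  - move=> c x Tx /=; rewrite -(fZ _ _ (MoDmx _ Tx)).
    by congr f; apply/matrixP => i j; rewrite !mxE ffunE.
  move=> x y /set_mem Tx /set_mem Ty /= /(inj _ _ (MoDmx _ Tx) (MoDmx _ Ty)) /matrixP xy.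
  by apply/ffunP => -[i j]; have := xy i j; rewrite !mxE.
pose i0 := Ordinal n0.
have dimZ : \dim (Fspan (centre S)) = \dim 'Z({:D}).
  pose T := [set z | oD z /\ z \in 'Z({:D})%VS].
  have -> : centre S = (fun z => f z%:M) @` T.
    apply/seteqP; split=> [x [/f_surj[M MoDM1 <-] MC]|_ [z [oDz zZ] <-]].
      have MN N : MoD N -> M *m N = N *m M.
        move=> MoDN; apply: inj; [exact: MoDM|exact: MoDM|].
        by rewrite !fmul // MC //; apply: f_S.
      (* Comparing column [i0] in the commutation of [M] with the matrix unit at [(i, i0)] shows
         that [M] is scalar. *)
      have Mz : M = (M i0 i0)%:M.
        apply/matrixP => k i; have /matrixP/(_ k i0) := MN _ (MoDd i i0).
        rewrite mxE (bigD1 i) //= mxE !eqxx mulr1 big1 => [|l li]; last first.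
          by rewrite mxE (negPf li) mulr0.
        rewrite addr0 mxE (bigD1 i0) //= mxE eqxx andbT big1 => [|l li]; last first.
          by rewrite mxE (negPf li) andbF mul0r.
        by rewrite addr0 mxE => ->; case: (k == i); rewrite ?mul1r ?mul0r.
      exists (M i0 i0); last by rewrite -Mz.
      split; first exact: MoDM1.
      apply: (valuation_ring_centre oDP) => y oDy.
      have /matrixP/(_ i0 i0) := MN _ (MoDs _ oDy).
      by rewrite {1 2}Mz -!scalar_mxM !mxE eqxx.
    split=> [|_ /f_surj[M MoDM1 <-]]; first exact/f_S/MoDs.
    rewrite -!fmul //; [|exact: MoDs..].
    congr f; apply/matrixP => i j; rewrite mul_scalar_mx mxE mxE (bigD1 j) //=.
    rewrite mxE eqxx big1 => [|l lj]; last by rewrite mxE (negPf lj) mulr0.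
    by rewrite addr0; move: zZ; rewrite memv_cap => /andP[_ /centvP->]; rewrite ?memvf.
  rewrite dim_Fspan_image.
  - by rewrite Fspan_valuation_centre.
  - by split=> //; apply: mem0v.
  - by move=> x y [ox xZ] [oy yZ]; split; [apply: oDD | apply: memvD].
  - by move=> c x [ox xZ]; split; [apply: oDZ | apply: memvZ].
  - move=> x y [ox xZ] [oy yZ]; rewrite raddfD.
    by rewrite (fM _ _ (MoDs _ ox) (MoDs _ oy)).1.
  - move=> c x [ox xZ]; rewrite -fZ; last exact: MoDs.
    congr f; apply/matrixP => i j; rewrite !mxE.
    by case: (i == j); rewrite ?mulr1n // !mulr0n scaler0.
  move=> x y /set_mem[ox _] /set_mem[oy _] /(inj _ _ (MoDs _ ox) (MoDs _ oy)).
  by move/matrixP/(_ i0 i0); rewrite !mxE eqxx.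
by rewrite dimS dimD dimZ mulnA expnMn.
Qed.

Lemma dim_nice_component (S : set A) (n s : nat) :
  mul_closed S -> nice_component S n s ->
  \dim (Fspan S) = ((n * s) ^ 2 * \dim (Fspan (centre S)))%N.
Proof.
move=> SM [[/(dim_matrix_ring_over_comm SM)-> ->]|]; first by rewrite muln1.
exact: dim_matrix_ring_over_valuation_ring.
Qed.

End ComponentDimension.

(** * Coefficients in the group algebra *)

Section GroupAlgebraTheory.
Variables (F : fieldType) (G : finGroupType).
Local Notation FG := (group_algebra F G).

Definition ga_coefo (g : G) (x : FG) : F^o := ga_coef x g.

Fact ga_coefo_is_linear (g : G) : linear (ga_coefo g).
Proof. by move=> c x y; rewrite /ga_coefo ga_addE ga_scaleE. Qed.
HB.instance Definition _ g := GRing.isLinear.Build F FG F^o _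
  (ga_coefo g) (ga_coefo_is_linear g).

Definition ga_elt (g : G) : FG := [ffun h => (h == g)%:R].

Lemma ga_coef_elt g h : ga_coef (ga_elt g) h = (h == g)%:R.
Proof. by rewrite /ga_coef ffunE. Qed.

Lemma ga_coef_sum (I : finType) (x : I -> FG) g :
  ga_coef (\sum_i x i) g = \sum_i ga_coef (x i) g.
Proof. exact: (raddf_sum (ga_coefo g)). Qed.

Lemma ga_sum_elt (x : FG) : x = \sum_g ga_coef x g *: ga_elt g.
Proof.
apply: ga_eqP => g; rewrite ga_coef_sum (bigD1 g) //= ga_scaleE ga_coef_elt eqxx.
rewrite mulr1 big1 ?addr0 // => h hg.
by rewrite ga_scaleE ga_coef_elt eq_sym (negPf hg) mulr0.
Qed.

Lemma ga_coef_mulr_elt (x : FG) g h :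
  ga_coef (x * ga_elt g) h = ga_coef x (h * g^-1)%g.
Proof.
rewrite ga_mulE (bigD1 (h * g^-1)%g) //= ga_coef_elt invMg invgK mulgKV eqxx mulr1.
rewrite big1 ?addr0 // => j jg; rewrite ga_coef_elt.
case: (_ =P g) jg => [<-|_ _]; last by rewrite mulr0.
by rewrite invMg invgK mulKVg eqxx.
Qed.

(** Both sides sum products of a coefficient of [x] at one group element and of [y] at its
    inverse. *)
Lemma ga_coef1_mulC (x y : FG) : ga_coef (x * y) 1%g = ga_coef (y * x) 1%g.
Proof.
rewrite !ga_mulE (reindex_inj invg_inj) /=; apply: eq_bigr => h _.
by rewrite !mulg1 invgK mulrC.
Qed.

Lemma ga_coef_mulr_elt1 (x : FG) g : ga_coef x g = ga_coef (x * ga_elt g^-1) 1%g.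
Proof. by rewrite ga_coef_mulr_elt mul1g invgK. Qed.

End GroupAlgebraTheory.

(** * Both conductors as the dual of the order *)

Section Conductor.
Variables (o : idomainType) (G : finGroupType).
Local Notation K := {fraction o}.
Local Notation A := (group_algebra K G).
Variable Gamma : set A.
Hypothesis Gamma_mul : mul_closed Gamma.
Hypothesis Lambda_sub : integral_group_ring o G `<=` Gamma.

Lemma integers_nat n : integers o n%:R.
Proof. by exists n%:R => //; rewrite rmorph_nat. Qed.

Lemma integers_sum (I : finType) (x : I -> K) :
  (forall i, integers o (x i)) -> integers o (\sum_i x i).
Proof.
move=> ox; elim/big_ind: _ => [|_ _ [a _ <-] [b _ <-]|i _]; last exact: ox.
  exact: (integers_nat 0).
by exists (a + b) => //; rewrite rmorphD.
Qed.

Lemma Gamma_elt g : Gamma (ga_elt K g).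
Proof. by apply: Lambda_sub => h; rewrite ga_coef_elt; apply: integers_nat. Qed.

Lemma Gamma_1 : Gamma 1.
Proof. by apply: Lambda_sub => h; rewrite ga_oneE; apply: integers_nat. Qed.

(* Lambda is its own dual for the form sending x, y to the coefficient of 1 in
   x * y, so both conductors are the dual of Gamma. *)
Lemma conductor_lP x : conductor_l Gamma (integral_group_ring o G) x <->
  forall y, Gamma y -> integers o (ga_coef (x * y) 1%g).
Proof.
split=> [[_ xL] y Gy|xo]; first exact: xL.
(* The coefficient of [x * y] at [g] is that of 1 in [x * (y * g^-1)], and [y * g^-1] stays in
   [Gamma]. *)
have xL y : Gamma y -> integral_group_ring o G (x * y).
  move=> Gy g; rewrite ga_coef_mulr_elt1 -mulrA; apply/xo/Gamma_mul => //.
  exact: Gamma_elt.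
by split=> //; rewrite -[x]mulr1; apply/Lambda_sub/xL/Gamma_1.
Qed.

Lemma conductor_rP x : conductor_r Gamma (integral_group_ring o G) x <->
  forall y, Gamma y -> integers o (ga_coef (x * y) 1%g).
Proof.
split=> [[_ xL] y Gy|xo]; first by rewrite ga_coef1_mulC; apply: xL.
(* By symmetry of the form, the coefficient of [y * x] at [g] is that of 1 in [x * (g^-1 * y)]. *)
have xL y : Gamma y -> integral_group_ring o G (y * x).
  move=> Gy g; rewrite ga_coef_mulr_elt1 -mulrA ga_coef1_mulC -mulrA.
  by apply/xo/Gamma_mul => //; apply: Gamma_elt.
by split=> //; rewrite -[x]mul1r; apply/Lambda_sub/xL/Gamma_1.
Qed.

End Conductor.

(** * Central idempotents of the decomposition *)

Section Decomposition.
Variables (F : fieldType) (A : falgType F) (Gamma : set A).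
Variables (k : nat) (T : 'I_k -> set A).
Hypothesis Gamma_span : Fspan Gamma = fullv.
Hypothesis Gamma1 : Gamma 1.
Hypothesis Gamma_sum : ring_direct_sum Gamma T.

Lemma component_sub i : T i `<=` Gamma.
Proof.
case: Gamma_sum => -[-> _] Tr _ x Tx; exists (fun j => if j == i then x else 0).
  by move=> j; case: eqP => [->|_] //; have [[]] := Tr j.
by rewrite -big_mkcond big_pred1_eq.
Qed.

Lemma component_mulr i x y : T i x -> Gamma y -> T i (x * y).
Proof.
case: Gamma_sum => -[-> _] Tr T0 Tx [z Tz ->].
rewrite mulr_sumr (bigD1 i) //= big1 ?addr0 => [|j ji].
  by have [_ TM _] := Tr i; apply: TM.
by apply: T0 Tx (Tz j); rewrite eq_sym.
Qed.

Lemma Fspan_component_mulr i x v : x \in Fspan (T i) -> x * v \in Fspan (T i).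
Proof.
move=> xT; apply: (Fspan_mul (@component_mulr i) xT).
by rewrite Gamma_span memvf.
Qed.

(** [e i] is the identity of [T i]. It commutes with [Gamma], hence with all of [A], which [Gamma]
    spans. *)
Lemma component_idempotents : exists e : 'I_k -> A,
  [/\ forall i x, e i * x \in Fspan (T i), forall i x, e i * x = x * e i,
      forall i x, x \in Fspan (T i) -> e i * x = x,
      forall x, x = \sum_i e i * x &
      forall i j x, i != j -> x \in Fspan (T j) -> e i * x = 0].
Proof.
case: Gamma_sum => -[GammaE _] Tr T0.
have /choice[e eP] i : exists e, is_identity (T i) e by case: (Tr i).
have eT i : T i (e i) by have [] := eP i.
have eS i : e i \in Fspan (T i) by apply: mem_Fspan.
have eid i x : x \in Fspan (T i) -> e i * x = x.
  move=> xT; have := @Fspan_eqfun _ _ _ (T i) (amull (e i)) (amull 1) _ x xT.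
  rewrite !lfunE /= mul1r; apply=> y Ty.
  by rewrite !lfunE /= mul1r; have [_ /(_ y Ty)[]] := eP i.
have eC i x : e i * x = x * e i.
  have xG : x \in Fspan Gamma by rewrite Gamma_span memvf.
  apply: (@Fspan_comm _ _ [set e i] Gamma) xG; last exact: mem_Fspan.
  rewrite GammaE => _ y -> [z Tz ->].
  rewrite mulr_sumr mulr_suml; apply: eq_bigr => j _.
  have [<-|ij] := eqVneq i j; last by rewrite (T0 i j) // (T0 j i) // eq_sym.
  by have [_ /(_ _ (Tz i))[-> ->]] := eP i.
(* If [z i] are the components of 1, then [e i = e i * 1 = e i * z i = z i]. *)
have e1 : 1 = \sum_i e i.
  move: (Gamma1); rewrite GammaE => -[z Tz z1]; rewrite {1}z1; apply: eq_bigr => i _.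
  rewrite -[e i]mulr1 z1 mulr_sumr (bigD1 i) //= big1 ?addr0 => [|j ji].
    by have [_ /(_ _ (Tz i))[->]] := eP i.
  by rewrite (T0 i j) // eq_sym.
exists e; split=> // [i x|x|i j x ij xT].
- exact: Fspan_component_mulr.
- by rewrite -mulr_suml -e1 mul1r.
- by rewrite -(eid j x xT) mulrA (T0 i j (e i) (e j)) // mul0r.
Qed.

End Decomposition.

(** * The conductor formula, component by component *)

Theorem proposition6p12 (o : idomainType) (G : finGroupType)
    (o_cdvr : complete_dvr o)
    (cardG_neq0 : (#|G|%:R : {fraction o}) != 0)
    (Gamma : set (group_algebra {fraction o} G))
    (Gamma_nice : nice_fitting_order Gamma)
    (Lambda_sub : integral_group_ring o G `<=` Gamma)
    (k : nat) (Gamma_ : 'I_k -> set (group_algebra {fraction o} G))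
    (n s : 'I_k -> nat)
    (Gamma_sum : ring_direct_sum Gamma Gamma_)
    (Gamma_comp : forall i, nice_component (Gamma_ i) (n i) (s i))
    (Gamma_indec : forall i, indecomposable (centre (Gamma_ i)))
    (trd : 'I_k -> group_algebra {fraction o} G -> group_algebra {fraction o} G)
    (trdP : forall i, is_reduced_trace
       (Fspan (Gamma_ i)) (Fspan (centre (Gamma_ i))) (trd i)) :
  conductor_l Gamma (integral_group_ring o G) =
    conductor_r Gamma (integral_group_ring o G) /\
  is_direct_sum (conductor_l Gamma (integral_group_ring o G))
    (fun i => [set (#|G|%:R / (n i * s i)%:R) *: x
              | x in inverse_different (Gamma_ i) (trd i)]).
Proof.
have [[_ Gamma_mul _ Gamma_span] _] := Gamma_nice.
have Gamma1 := Gamma_1 Lambda_sub.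
have [v [v_val ov _]] := o_cdvr.
split; first by apply/seteqP; split=> x; rewrite conductor_lP // conductor_rP.
have [e [eB eC eid esum e0]] := component_idempotents Gamma_span Gamma1 Gamma_sum.
have Gmul i : mul_closed (Gamma_ i) by have [_ Tr _] := Gamma_sum; have [] := Tr i.
have dimZ i : (0 < \dim (Fspan (centre (Gamma_ i))))%N.
  have [[x Zx x0] _] := Gamma_indec i; rewrite lt0n dimv_eq0.
  by apply: contra_notN x0 => /eqP Z0; apply/eqP; rewrite -memv0 -Z0 mem_Fspan.
have trace_coef i x : x \in Fspan (Gamma_ i) ->
    #|G|%:R * ga_coef x 1%g = (n i * s i)%:R *
      ordinary_trace (Fspan (centre (Gamma_ i))) (trd i x).
  move=> xB; have [||||m [dimB tr]] := trace_mul_reduced_trace _ _ _ _ (trdP i).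
  - by apply: Fspan_sub => z [Gz _]; apply: mem_Fspan.
  - apply: Fspan_mul => z w [Gz zC] [Gw wC]; split=> [|y Gy]; first exact: Gmul.
    by rewrite -mulrA wC // mulrA zC // mulrA.
  - by move=> y w; apply: (Fspan_component_mulr Gamma_span Gamma_sum).
  - by apply: Fspan_comm => z y [_ zC] /zC.
  (* The two expressions for the dimension of the component are compared; the dimension of its
     centre is positive and cancels. *)
  have mE : m = (n i * s i)%N.
    apply/eqP; rewrite -(eqn_exp2r _ _ (ltn0Sn 1)) -(eqn_pmul2r (dimZ i)) -dimB.
    by rewrite (dim_nice_component v_val ov (Gmul i) (Gamma_comp i)).
  (* In the basis of group elements, every diagonal coefficient of left multiplication by [x] is the
     coefficient of 1 in [x]. *)
  rewrite -mE -(tr G (fun g => ga_elt _ g) (fun g => linfun (ga_coefo g))) //.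
    rewrite mulr_natl -sumr_const; apply: eq_bigr => g _.
    by rewrite lfunE /= /ga_coefo ga_coef_mulr_elt mulgV.
  move=> w; rewrite [LHS]ga_sum_elt; apply: eq_bigr => g _.
  by rewrite lfunE.
(* Otherwise [trace_coef] would make the coefficient of 1 vanish on the whole component; multiplying
   by group elements, every coefficient would vanish, against the nonzero element of the centre. *)
have ns0 i : (n i * s i)%:R != 0 :> {fraction o}.
  have [[x Zx x0] _] := Gamma_indec i; apply/eqP => ns0; apply: x0.
  apply: ga_eqP => g; rewrite ga_coef_mulr_elt1.
  apply: (mulfI cardG_neq0); rewrite (trace_coef i) ?ns0 ?mul0r.
    by rewrite /ga_coef ffunE mulr0.
  apply: (Fspan_component_mulr Gamma_span Gamma_sum); case: Zx => Gx _.
  exact: mem_Fspan.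
pose c i : {fraction o} := #|G|%:R / (n i * s i)%:R.
(* The scalar [c i] turns the trace form into the coefficient of 1, so the scaled inverse different
   is the dual of [Gamma_ i] for that form. *)
have differentP i x :
    [set c i *: w | w in inverse_different (Gamma_ i) (trd i)] x <->
    x \in Fspan (Gamma_ i) /\
    forall y, Gamma_ i y -> integers o (ga_coef (x * y) 1%g).
  have c0 : c i != 0 by rewrite mulf_neq0 ?invr_neq0.
  have trE w y : w \in Fspan (Gamma_ i) ->
      ordinary_trace (Fspan (centre (Gamma_ i))) (trd i (w * y)) =
      ga_coef (c i *: w * y) 1%g.
    move=> wB; rewrite -scalerAl ga_scaleE; apply: (mulfI (ns0 i)).
    rewrite -trace_coef; first by rewrite mulrA mulrCA mulfV ?mulr1.
    exact: (Fspan_component_mulr Gamma_span Gamma_sum).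
  split=> [[w [wB wo] <-]|[xB xo]].
    by split=> [|y Gy]; [apply: memvZ | rewrite -trE //; apply: wo].
  exists ((c i)^-1 *: x); last by rewrite scalerA mulfV ?scale1r.
  split=> [|y Gy]; first exact: memvZ.
  by rewrite trE ?memvZ // scalerA mulfV // scale1r; apply: xo.
split; last first.
  move=> y yD y0 i; have yB j : y j \in Fspan (Gamma_ j).
    by have /differentP[] := yD j.
  (* Multiplying the vanishing sum by [e i] isolates [y i]. *)
  rewrite -(eid i (y i) (yB i)) -[RHS](mulr0 (e i)) -y0 mulr_sumr.
  by rewrite [RHS](bigD1 i) //= big1 ?addr0 // => j ji; apply: (e0 i j); rewrite // eq_sym.
apply/seteqP; split=> x.
  move=> /(conductor_lP Gamma_mul Lambda_sub) xo.
  exists (fun i => e i * x); last exact: esum.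
  move=> i; apply/differentP; split=> // y Gy.
  (* For [y] in [Gamma_ i], [e i * x * y = x * (e i * y) = x * y]. *)
  rewrite eC -mulrA (eid i) ?mem_Fspan //.
  by apply: xo; apply: (component_sub Gamma_sum Gy).
case=> y yD ->; apply/(conductor_lP Gamma_mul Lambda_sub) => z Gz.
rewrite mulr_suml ga_coef_sum; apply: integers_sum => i.
have /differentP[yB yo] := yD i.
have [[GE _] _ Tmul] := Gamma_sum; move: Gz; rewrite GE => -[t Tt ->].
rewrite mulr_sumr (bigD1 i) //= big1 ?addr0 => [|j ji]; first exact: yo.
(* Cross terms vanish: [y i] absorbs [e i], which is central and annihilates [t j]. *)
by rewrite -(eid i _ yB) -mulrA eC -mulrA -eC (e0 i j) ?mulr0 ?mem_Fspan // eq_sym.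
Qed.
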